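(* Let $p : B \to E$ be a morphism of commutative rings. Then $p$ is an effective descent morphism for modules if and only if $p$ is pure as a morphism of $B$-modules.
   Context: Rings are commutative with $1$ and ring morphisms preserve $1$; $E$ is regarded as a $B$-module via $p$. $\mathbf{Mod}_B$ denotes the category of $B$-modules. A morphism $f : M \to M'$ of $B$-modules is pure if for every $B$-module $N$ the map $N\otimes_B f : N\otimes_B M \to N\otimes_B M'$ is a monomorphism. A morphism of commutative rings $p: B\to E$ is called pure if it is pure as a morphism of $B$-modules. Let $\mathcal{E}$ be the category dual to the category of commutative rings. The assignments $B \mapsto \mathbf{Mod}_B$ and $(p : B\to E) \mapsto (p^* = E\otimes_B - : \mathbf{Mod}_B \to \mathbf{Mod}_E)$ define a pseudo-functor $\mathcal{E}^{\mathrm{op}} \to \mathbf{CAT}$ (an $\mathcal{E}$-indexed category). A ring morphism $p$ is called an effective descent morphism for modules if the canonical functor $K_p : \mathbf{Mod}_B \to \mathrm{Des}(p)$ is an equivalence of categories, where $\mathrm{Des}(p)$ is the category of descent data relative to $p$ for this indexed category: its objects are pairs $(N,\varphi)$ with $N$ an $E$-module and $\varphi : N\otimes_B E \to E\otimes_B N$ an isomorphism of $E\otimes_B E$-modules satisfying the usual cocycle condition over $E\otimes_B E\otimes_B E$, its morphisms are the $E$-linear maps compatible with the isomorphisms $\varphi$, and $K_p(M) = E\otimes_B M$ with its canonical descent datum. Since this indexed category satisfies the dual of the Beck-Chevalley condition, $p$ is an effective descent morphism for modules if and only if the functor $p^* = E\otimes_B - : \mathbf{Mod}_B\to\mathbf{Mod}_E$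 (left adjoint to restriction of scalars) is comonadic, i.e. the comparison functor from $\mathbf{Mod}_B$ to the category of coalgebras over the induced comonad on $\mathbf{Mod}_E$ is an equivalence of categories. *)

(* Defs.v *)
From HB Require Import structures.
From mathcomp Require Import all_boot all_order all_algebra generic_quotient.
From mathcomp Require Import boolp.
Set Implicit Arguments.
Unset Strict Implicit.
Unset Printing Implicit Defensive.
Import GRing.Theory.
Local Open Scope ring_scope.
Local Open Scope quotient_scope.

Reserved Notation "x ⊗ y" (at level 40, left associativity).

(* comPzRingType, and not comNzRingType, so that the zero ring is allowed. *)

Lemma linear_ext (R : pzRingType) (U V : lmodType R) (f g : {linear U -> V}) :
  f =1 g -> f = g.
Proof.
case: f => f [[f1] [f2]]; case: g => g [[g1] [g2]] /= /funext fg.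
move: f1 f2 g1 g2; rewrite fg => f1 f2 g1 g2.
by rewrite (Prop_irrelevance f1 g1) (Prop_irrelevance f2 g2).
Qed.

Section LinearMaps.
Variable R : pzRingType.

Definition mklin (U V : lmodType R) (f : U -> V) (fL : linear f)
  : {linear U -> V} := HB.pack f (GRing.isLinear.Build R U V *:%R f fL).

Lemma mklinE (U V : lmodType R) (f : U -> V) (fL : linear f) x : mklin fL x = f x.
Proof. by []. Qed.

Definition lid (U : lmodType R) : {linear U -> U} := idfun.
Definition lcomp (U V W : lmodType R) (g : {linear V -> W}) (f : {linear U -> V})
  : {linear U -> W} := g \o f.

Lemma lidE (U : lmodType R) (x : U) : lid U x = x.
Proof. by []. Qed.
Lemma lcompE (U V W : lmodType R) (g : {linear V -> W}) (f : {linear U -> V}) x :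
  lcomp g f x = g (f x).
Proof. by []. Qed.
End LinearMaps.

Arguments mklin : simpl never.
Arguments lid {R} U : simpl never.
Arguments lcomp {R U V W} g f : simpl never.

Section Tensor.
Variables (B : comPzRingType) (M N : lmodType B).

(* M ⊗_B N is the commutative monoid of formal finite sums of pairs (x, y),
   modulo the congruence generated by the relations below. *)
Inductive tensor_rel : seq (M * N) -> seq (M * N) -> Prop :=
| trel_refl s : tensor_rel s s
| trel_sym s t : tensor_rel s t -> tensor_rel t s
| trel_trans s t u : tensor_rel s t -> tensor_rel t u -> tensor_rel s u
| trel_cat s s' t t' :
    tensor_rel s s' -> tensor_rel t t' -> tensor_rel (s ++ t) (s' ++ t')
| trel_catC s t : tensor_rel (s ++ t) (t ++ s)
| trel_0l y : tensor_rel [:: (0, y)] [::]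
| trel_Dl x x' y : tensor_rel [:: (x + x', y)] [:: (x, y); (x', y)]
| trel_Dr x y y' : tensor_rel [:: (x, y + y')] [:: (x, y); (x, y')]
| trel_Z a x y : tensor_rel [:: (a *: x, y)] [:: (x, a *: y)].

Definition tensor_relb s t := `[< tensor_rel s t >].

Lemma tensor_relb_refl : reflexive tensor_relb.
Proof. by move=> s; apply/asboolP; apply: trel_refl. Qed.
Lemma tensor_relb_sym : symmetric tensor_relb.
Proof. by move=> s t; apply/asboolP/asboolP; apply: trel_sym. Qed.
Lemma tensor_relb_trans : transitive tensor_relb.
Proof.
by move=> t s u /asboolP st /asboolP tu; apply/asboolP; apply: trel_trans tu.
Qed.

Canonical tensor_equiv :=
  EquivRel tensor_relb tensor_relb_refl tensor_relb_sym tensor_relb_trans.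

Definition tensor_type := {eq_quot tensor_equiv}.
HB.instance Definition _ := Choice.on tensor_type.
HB.instance Definition _ := EqQuotient.on tensor_type.

Definition tclass (s : seq (M * N)) : tensor_type := \pi_tensor_type s.

Lemma tclassP s t : tclass s = tclass t <-> tensor_rel s t.
Proof.
split=> [/eqmodP /asboolP //|st].
by apply/eqmodP; apply/asboolP.
Qed.

Lemma tclassK (u : tensor_type) : tclass (repr u) = u.
Proof. exact: reprK. Qed.

Lemma repr_tclass s : tensor_rel (repr (tclass s)) s.
Proof. by apply/tclassP; rewrite tclassK. Qed.

Definition tzero : tensor_type := tclass [::].
Definition tadd (u v : tensor_type) : tensor_type := tclass (repr u ++ repr v).
Definition tscale (a : B) (u : tensor_type) : tensor_type :=
  tclass [seq (a *: z.1, z.2) | z <- repr u].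
Definition topp (u : tensor_type) : tensor_type := tscale (- 1) u.

Lemma taddE s t : tadd (tclass s) (tclass t) = tclass (s ++ t).
Proof. by apply/tclassP; apply: trel_cat; apply: repr_tclass. Qed.

Lemma trel_scale a s t : tensor_rel s t ->
  tensor_rel [seq (a *: z.1, z.2) | z <- s] [seq (a *: z.1, z.2) | z <- t].
Proof.
elim=> {s t} /=.
- by move=> s; apply: trel_refl.
- by move=> s t _; apply: trel_sym.
- by move=> s t u _ st _; apply: trel_trans.
- by move=> s s' t t' _ ss' _ tt'; rewrite !map_cat; apply: trel_cat.
- by move=> s t; rewrite !map_cat; apply: trel_catC.
- by move=> y; rewrite scaler0; apply: trel_0l.
- by move=> x x' y; rewrite scalerDr; apply: trel_Dl.
- by move=> x y y'; apply: trel_Dr.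
- by move=> b x y; rewrite scalerA mulrC -scalerA; apply: trel_Z.
Qed.

Lemma tscaleE a s :
  tscale a (tclass s) = tclass [seq (a *: z.1, z.2) | z <- s].
Proof. by apply/tclassP; apply: trel_scale; apply: repr_tclass. Qed.

Lemma taddA : associative tadd.
Proof.
move=> u v w; rewrite -(tclassK u) -(tclassK v) -(tclassK w).
by rewrite !taddE catA.
Qed.
Lemma taddC : commutative tadd.
Proof.
by move=> u v; rewrite -(tclassK u) -(tclassK v) !taddE; apply/tclassP/trel_catC.
Qed.
Lemma tadd0 : left_id tzero tadd.
Proof. by move=> u; rewrite -(tclassK u) taddE. Qed.

Lemma taddN : left_inverse tzero topp tadd.
Proof.
move=> u; rewrite -(tclassK u) /topp tscaleE taddE; apply/tclassP.
elim: (repr u) => [|[x y] s IH] /=; first exact: trel_refl.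
have -> : (-1 *: x, y) :: [seq (-1 *: z.1, z.2) | z <- s] ++ (x, y) :: s =
  [:: (-1 *: x, y)] ++ ([seq (-1 *: z.1, z.2) | z <- s] ++ [:: (x, y)]) ++ s.
  by rewrite -catA.
apply: (@trel_trans _ ([:: (-1 *: x, y)] ++
  ([:: (x, y)] ++ [seq (-1 *: z.1, z.2) | z <- s]) ++ s)).
  apply: trel_cat; first exact: trel_refl.
  by apply: trel_cat; [apply: trel_catC | apply: trel_refl].
apply: (@trel_trans _ (([:: (-1 *: x, y)] ++ [:: (x, y)]) ++
  ([seq (-1 *: z.1, z.2) | z <- s] ++ s))); first by rewrite -!catA; apply: trel_refl.
apply: (@trel_trans _ ([::] ++ [::])); last exact: trel_refl.
apply: trel_cat => //.
apply: trel_trans (trel_0l y).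
apply: trel_sym; have -> : 0 = -1 *: x + x by rewrite scaleN1r addNr.
exact: trel_Dl.
Qed.

HB.instance Definition _ := GRing.isZmodule.Build tensor_type taddA taddC tadd0 taddN.

Lemma tscaleA a b u : tscale a (tscale b u) = tscale (a * b) u.
Proof.
rewrite -(tclassK u) !tscaleE -map_comp; congr tclass.
by apply: eq_map => z /=; rewrite scalerA.
Qed.
Lemma tscale1 : left_id 1 tscale.
Proof.
move=> u; rewrite -{1}(tclassK u) tscaleE -[RHS]tclassK; congr tclass.
by rewrite -[RHS]map_id; apply: eq_map => -[x y] /=; rewrite scale1r.
Qed.
Lemma tscaleDr : right_distributive tscale +%R.
Proof.
move=> a u v; rewrite /+%R /= -(tclassK u) -(tclassK v).
by rewrite taddE !tscaleE taddE map_cat.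
Qed.
Lemma tscaleDl u : {morph tscale^~ u : a b / a + b}.
Proof.
move=> a b; rewrite [RHS]/+%R /= -(tclassK u) !tscaleE taddE; apply/tclassP.
elim: (repr u) => [|[x y] s IH] /=; first exact: trel_refl.
set s1 := map _ _ in IH *; set s2 := map _ _ in IH *; set s3 := map _ _ in IH *.
apply: (@trel_trans _ ([:: (a *: x, y); (b *: x, y)] ++ (s2 ++ s3))).
  by rewrite -cat1s; apply: trel_cat => //; rewrite scalerDl; apply: trel_Dl.
rewrite /= -(cat1s (a *: x, y)) -[X in tensor_rel _ X](cat1s (a *: x, y)).
apply: trel_cat; first exact: trel_refl.
rewrite -cat1s -(cat1s (b *: x, y) s3) !catA.
by apply: trel_cat; [apply: trel_catC | apply: trel_refl].
Qed.

HB.instance Definition _ := GRing.Zmodule_isLmodule.Build B tensor_type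
  tscaleA tscale1 tscaleDr tscaleDl.

Definition tensor : lmodType B := GRing.Lmodule.clone B tensor_type _.

(* tclass, typed in the bundled module. *)
Definition tclassL : seq (M * N) -> tensor := tclass.

Lemma tclassD s t : tclassL (s ++ t) = tclassL s + tclassL t.
Proof. exact: esym (taddE s t). Qed.
Lemma tclassZ a s : tclassL [seq (a *: z.1, z.2) | z <- s] = a *: tclassL s.
Proof. exact: esym (tscaleE a s). Qed.

Definition tmul (x : M) (y : N) : tensor := tclassL [:: (x, y)].

End Tensor.

Arguments tensor : simpl never.
Arguments tmul {B M N} x y : simpl never.

Notation "x ⊗ y" := (tmul x y) : ring_scope.

Section TensorTheory.
Variables (B : comPzRingType) (M N : lmodType B).

Lemma tmulDl (x x' : M) (y : N) : (x + x') ⊗ y = x ⊗ y + x' ⊗ y.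
Proof. by rewrite -tclassD; apply/tclassP; apply: trel_Dl. Qed.
Lemma tmulDr (x : M) (y y' : N) : x ⊗ (y + y') = x ⊗ y + x ⊗ y'.
Proof. by rewrite -tclassD; apply/tclassP; apply: trel_Dr. Qed.
Lemma tmulZl a (x : M) (y : N) : (a *: x) ⊗ y = a *: (x ⊗ y).
Proof. by rewrite -tclassZ. Qed.
Lemma tmulZr a (x : M) (y : N) : x ⊗ (a *: y) = a *: (x ⊗ y).
Proof. by rewrite -tmulZl; apply/tclassP; apply: trel_sym; apply: trel_Z. Qed.
Lemma tmul0l (y : N) : (0 : M) ⊗ y = 0.
Proof. by rewrite -(scale0r (0 : M)) tmulZl scale0r. Qed.
Lemma tmul0r (x : M) : x ⊗ (0 : N) = 0.
Proof. by rewrite -(scale0r (0 : N)) tmulZr scale0r. Qed.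

Lemma tclass_sum (s : seq (M * N)) : tclassL s = \sum_(z <- s) z.1 ⊗ z.2.
Proof.
elim: s => [|[x y] s IH]; first by rewrite big_nil.
by rewrite big_cons -IH -tclassD.
Qed.

Lemma tensor_ind (P : tensor M N -> Prop) :
  P 0 -> (forall x y, P (x ⊗ y)) -> (forall t u, P t -> P u -> P (t + u)) ->
  forall t, P t.
Proof.
move=> P0 Pm PD t; have -> : t = tclassL (repr (t : tensor_type M N)).
  by rewrite /tclassL tclassK.
by rewrite tclass_sum; apply: big_ind.
Qed.

Lemma tensor_ext (P : lmodType B) (f g : {linear tensor M N -> P}) :
  (forall x y, f (x ⊗ y) = g (x ⊗ y)) -> f =1 g.
Proof.
move=> fg; apply: tensor_ind => //; first by rewrite !linear0.
by move=> t u ft fu; rewrite !linearD ft fu.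
Qed.

(* The universal property of the tensor product. *)
Section Lift.
Variables (P : lmodType B) (f : M -> N -> P).
Hypothesis fl : forall y, linear (f^~ y).
Hypothesis fr : forall x, linear (f x).

Definition tlift_fun (t : tensor M N) : P :=
  \sum_(z <- repr (t : tensor_type M N)) f z.1 z.2.

Let f0l y : f 0 y = 0.
Proof. by have := fl y (-1) 0 0; rewrite scaler0 addr0 scaleN1r addNr. Qed.
Let f0r x : f x 0 = 0.
Proof. by have := fr x (-1) 0 0; rewrite scaler0 addr0 scaleN1r addNr. Qed.

Lemma tlift_class s : tlift_fun (tclassL s) = \sum_(z <- s) f z.1 z.2.
Proof.
rewrite /tlift_fun /tclassL.
have := repr_tclass s; move: (repr _) => r; elim=> {r s} /=.
- by [].
- by [].
- by move=> s t u _ -> _ ->.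
- by move=> s s' t t' _ IH _ IH'; rewrite !big_cat /= IH IH'.
- by move=> s t; rewrite !big_cat /= addrC.
- by move=> y; rewrite big_seq1 big_nil f0l.
- move=> x x' y; rewrite !big_cons !big_nil !addr0 /=.
  by rewrite -{1}[x]scale1r fl scale1r.
- move=> x y y'; rewrite !big_cons !big_nil !addr0 /=.
  by rewrite -{1}[y]scale1r fr scale1r.
- move=> a x y; rewrite !big_seq1 /= -[a *: x]addr0 -[a *: y]addr0 fl fr.
  by rewrite f0l f0r.
Qed.

Lemma tlift_is_linear : linear tlift_fun.
Proof.
move=> a u v; rewrite -(tclassK u) -(tclassK v) -tclassZ -tclassD.
rewrite !tlift_class big_cat /=; congr (_ + _).
rewrite big_map scaler_sumr; apply: eq_bigr => z _ /=.
by rewrite -[a *: z.1]addr0 fl f0l addr0.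
Qed.

Definition tlift : {linear tensor M N -> P} := mklin tlift_is_linear.

Lemma tliftE x y : tlift (x ⊗ y) = f x y.
Proof. by rewrite /tlift mklinE tlift_class big_seq1. Qed.

End Lift.
End TensorTheory.

Arguments tlift : simpl never.

Section TensorMaps.
Variable B : comPzRingType.

Lemma tmul_is_linear (M N : lmodType B) (x : M) : linear (@tmul B M N x).
Proof. by move=> a y y'; rewrite tmulDr tmulZr. Qed.

Section Map.
Variables (M M' N N' : lmodType B) (f : {linear M -> M'}) (g : {linear N -> N'}).

Lemma tmap_linl y : linear (fun x => f x ⊗ g y).
Proof. by move=> a x x'; rewrite linearP tmulDl tmulZl. Qed.
Lemma tmap_linr x : linear (fun y => f x ⊗ g y).
Proof. by move=> a y y'; rewrite linearP tmulDr tmulZr. Qed.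

Definition tmap : {linear tensor M N -> tensor M' N'} := tlift tmap_linl tmap_linr.

Lemma tmapE x y : tmap (x ⊗ y) = f x ⊗ g y.
Proof. exact: tliftE. Qed.
End Map.

Section Swap.
Variables M N : lmodType B.

Lemma tswap_linl (y : N) : linear (fun x : M => y ⊗ x).
Proof. exact: tmul_is_linear. Qed.
Lemma tswap_linr (x : M) : linear (fun y : N => y ⊗ x).
Proof. by move=> a y y'; rewrite tmulDl tmulZl. Qed.

Definition tswap : {linear tensor M N -> tensor N M} := tlift tswap_linl tswap_linr.

Lemma tswapE x y : tswap (x ⊗ y) = y ⊗ x.
Proof. exact: tliftE. Qed.
End Swap.

Section Assoc.
Variables L M N : lmodType B.

Lemma tassoc_in_linl (z : N) (y : M) : linear (fun x : L => x ⊗ (y ⊗ z)).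
Proof. by move=> a x x'; rewrite tmulDl tmulZl. Qed.
Lemma tassoc_in_linr (z : N) (x : L) : linear (fun y : M => x ⊗ (y ⊗ z)).
Proof. by move=> a y y'; rewrite tmulDl tmulZl tmulDr tmulZr. Qed.
Definition tassoc_in (t : tensor L M) (z : N) : tensor L (tensor M N) :=
  tlift (tassoc_in_linl z) (tassoc_in_linr z) t.

Lemma tassoc_linl z : linear (tassoc_in^~ z).
Proof. by move=> a t t'; rewrite /tassoc_in linearP. Qed.
Lemma tassoc_linr t : linear (tassoc_in t).
Proof.
move=> a z z'; rewrite /tassoc_in; elim/tensor_ind: t => [|x y|t u IHt IHu].
- by rewrite !linear0 addr0.
- by rewrite !tliftE !(tmulDr, tmulZr).
- by rewrite !linearD IHt IHu addrACA.
Qed.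

(* (x ⊗ y) ⊗ z is sent to x ⊗ (y ⊗ z). *)
Definition tassoc : {linear tensor (tensor L M) N -> tensor L (tensor M N)} :=
  tlift tassoc_linl tassoc_linr.

Lemma tassocE x y z : tassoc ((x ⊗ y) ⊗ z) = x ⊗ (y ⊗ z).
Proof. by rewrite /tassoc tliftE /tassoc_in tliftE. Qed.

Lemma tassocV_in_linl (x : L) (z : N) : linear (fun y : M => (x ⊗ y) ⊗ z).
Proof. by move=> a y y'; rewrite tmulDr tmulZr tmulDl tmulZl. Qed.
Lemma tassocV_in_linr (x : L) (y : M) : linear (fun z : N => (x ⊗ y) ⊗ z).
Proof. exact: tmul_is_linear. Qed.
Definition tassocV_in (x : L) (t : tensor M N) : tensor (tensor L M) N :=
  tlift (tassocV_in_linl x) (tassocV_in_linr x) t.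

Lemma tassocV_linl t : linear (tassocV_in^~ t).
Proof.
move=> a x x'; rewrite /tassocV_in; elim/tensor_ind: t => [|y z|t u IHt IHu].
- by rewrite !linear0 addr0.
- by rewrite !tliftE !(tmulDl, tmulZl).
- by rewrite !linearD IHt IHu addrACA.
Qed.
Lemma tassocV_linr x : linear (tassocV_in x).
Proof. by move=> a t t'; rewrite /tassocV_in linearP. Qed.

Definition tassocV : {linear tensor L (tensor M N) -> tensor (tensor L M) N} :=
  tlift tassocV_linl tassocV_linr.

Lemma tassocVE x y z : tassocV (x ⊗ (y ⊗ z)) = (x ⊗ y) ⊗ z.
Proof. by rewrite /tassocV tliftE /tassocV_in tliftE. Qed.
End Assoc.

Lemma tmap_id (V W : lmodType B) (f : {linear V -> V}) (g : {linear W -> W}) t :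
  f =1 id -> g =1 id -> tmap f g t = t.
Proof.
move=> fi gi; elim/tensor_ind: t => [|x y|t u IHt IHu]; first exact: linear0.
- by rewrite tmapE fi gi.
- by rewrite linearD IHt IHu.
Qed.

Lemma tmap_comp (V V' V'' W W' W'' : lmodType B) (f' : {linear V' -> V''})
    (f : {linear V -> V'}) (g' : {linear W' -> W''}) (g : {linear W -> W'})
    (f'' : {linear V -> V''}) (g'' : {linear W -> W''}) t :
  f'' =1 f' \o f -> g'' =1 g' \o g -> tmap f'' g'' t = tmap f' g' (tmap f g t).
Proof.
move=> ff gg; elim/tensor_ind: t => [|x y|t u IHt IHu]; first by rewrite !linear0.
- by rewrite !tmapE ff gg.
- by rewrite !linearD IHt IHu.
Qed.

Lemma tswapK (V W : lmodType B) (t : tensor V W) : tswap W V (tswap V W t) = t.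
Proof.
elim/tensor_ind: t => [|x y|t u IHt IHu]; first by rewrite !linear0.
- by rewrite !tswapE.
- by rewrite !linearD IHt IHu.
Qed.

End TensorMaps.

Arguments tmap {B M M' N N'} f g : simpl never.
Arguments tswap {B} M N : simpl never.
Arguments tassoc {B} L M N : simpl never.
Arguments tassocV {B} L M N : simpl never.

Section Restriction.
Variables (B E : comPzRingType) (p : {rmorphism B -> E}).

Section Module.
Variable N : lmodType E.

Definition restr_type : Type := N.
HB.instance Definition _ := GRing.Zmodule.on restr_type.

Definition restr_scale (b : B) (x : restr_type) : restr_type := p b *: (x : N).

Lemma restr_scaleA a b x : restr_scale a (restr_scale b x) = restr_scale (a * b) x.
Proof. by rewrite /restr_scale rmorphM scalerA. Qed.
Lemma restr_scale1 : left_id 1 restr_scale.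
Proof. by move=> x; rewrite /restr_scale rmorph1 scale1r. Qed.
Lemma restr_scaleDr : right_distributive restr_scale +%R.
Proof. by move=> a x y; rewrite /restr_scale scalerDr. Qed.
Lemma restr_scaleDl x : {morph restr_scale^~ x : a b / a + b}.
Proof. by move=> a b; rewrite /restr_scale rmorphD scalerDl. Qed.

HB.instance Definition _ := GRing.Zmodule_isLmodule.Build B restr_type
  restr_scaleA restr_scale1 restr_scaleDr restr_scaleDl.

(* Restriction of scalars along p. *)
Definition restr : lmodType B := GRing.Lmodule.clone B restr_type _.

Lemma restrZ b (x : restr) : b *: x = p b *: (x : N).
Proof. by []. Qed.

Lemma homothety_is_linear (e : E) :
  linear (fun x : restr => (e *: (x : N)) : restr).
Proof. by move=> b x y; rewrite !restrZ scalerDr !scalerA mulrC. Qed.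
Definition homothety e : {linear restr -> restr} := mklin (homothety_is_linear e).

Lemma homothetyE e x : homothety e x = e *: (x : N).
Proof. by []. Qed.
End Module.

Section Hom.
Variables (N N' : lmodType E) (h : {linear N -> N'}).
Lemma restr_hom_is_linear : linear (fun x : restr N => (h x) : restr N').
Proof. by move=> b x y; rewrite !restrZ linearP. Qed.
Definition restr_hom : {linear restr N -> restr N'} := mklin restr_hom_is_linear.
Lemma restr_homE x : restr_hom x = h x.
Proof. by []. Qed.
End Hom.

Lemma algmap_is_linear : linear (fun b : B^o => (p b) : restr E^o).
Proof. by move=> a x y; rewrite rmorphD rmorphM. Qed.
(* p itself, as a morphism of B-modules. *)
Definition algmap : {linear B^o -> restr E^o} := mklin algmap_is_linear.
Lemma algmapE b : algmap b = p b.
Proof. by []. Qed.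

End Restriction.

Arguments restr : simpl never.
Arguments homothety {B E} p N e : simpl never.
Arguments restr_hom {B E} p {N N'} h : simpl never.
Arguments algmap {B E} p : simpl never.

(* For B-algebras A and C, an A-module M and a C-module N: the ring A ⊗_B C and
   its module M ⊗_B N, both carried by the tensor product of B-modules. *)
Section TensorAlgebra.
Variables (B A C : comPzRingType) (p : {rmorphism B -> A}) (q : {rmorphism B -> C}).

Section Action.
Variables (M : lmodType A) (N : lmodType C).
Implicit Type t : tensor (restr p M) (restr q N).

Definition tact_pure t (a : restr p A^o) (c : restr q C^o) :=
  tmap (homothety p M a) (homothety q N c) t.

Lemma tact_linl t c : linear ((tact_pure t)^~ c).
Proof.
move=> b x x'; rewrite /tact_pure; elim/tensor_ind: t => [|m n|t u IHt IHu].
- by rewrite !linear0 addr0.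
- by rewrite !tmapE !homothetyE scalerDl -scalerA tmulDl -tmulZl.
- by rewrite !linearD IHt IHu addrACA.
Qed.
Lemma tact_linr t a : linear (tact_pure t a).
Proof.
move=> b x x'; rewrite /tact_pure; elim/tensor_ind: t => [|m n|t u IHt IHu].
- by rewrite !linear0 addr0.
- by rewrite !tmapE !homothetyE scalerDl -scalerA tmulDr -tmulZr.
- by rewrite !linearD IHt IHu addrACA.
Qed.

(* The action of A ⊗_B C: (a ⊗ c) (m ⊗ n) = (a m) ⊗ (c n). *)
Definition tact (s : tensor (restr p A^o) (restr q C^o)) t :
  tensor (restr p M) (restr q N) := tlift (tact_linl t) (tact_linr t) s.

Lemma tactE (a : restr p A^o) (c : restr q C^o) (m : restr p M) (n : restr q N) :
  tact (a ⊗ c) (m ⊗ n) =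
  (((a : A) *: (m : M)) : restr p M) ⊗ (((c : C) *: (n : N)) : restr q N).
Proof. by rewrite /tact tliftE /tact_pure tmapE. Qed.

Lemma tact0l t : tact 0 t = 0. Proof. exact: linear0. Qed.
Lemma tactDl t s s' : tact (s + s') t = tact s t + tact s' t.
Proof. exact: linearD. Qed.
Lemma tactDr s t t' : tact s (t + t') = tact s t + tact s t'.
Proof.
elim/tensor_ind: s => [|a c|s u IHs IHu]; first by rewrite !tact0l addr0.
- by rewrite /tact !tliftE /tact_pure linearD.
- by rewrite !tactDl IHs IHu addrACA.
Qed.
Lemma tact0r s : tact s 0 = 0.
Proof. by apply: (addrI (tact s 0)); rewrite -tactDr !addr0. Qed.
Lemma tact1 t : tact ((1 : restr p A^o) ⊗ (1 : restr q C^o)) t = t.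
Proof.
elim/tensor_ind: t => [|m n|t u IHt IHu]; first by rewrite tact0r.
- by rewrite tactE !scale1r.
- by rewrite tactDr IHt IHu.
Qed.
End Action.

Lemma tactA (M : lmodType A) (N : lmodType C) r s
    (t : tensor (restr p M) (restr q N)) :
  tact r (tact s t) = tact (tact r s) t.
Proof.
elim/tensor_ind: r => [|a c|r r' IHr IHr']; first by rewrite !tact0l.
  elim/tensor_ind: s => [|a' c'|s s' IHs IHs'].
  - by rewrite !(tact0l, tact0r).
  - elim/tensor_ind: t => [|m n|t t' IHt IHt']; first by rewrite !tact0r.
    + by rewrite !tactE !scalerA.
    + by rewrite !tactDr IHt IHt'.
  - by rewrite !(tactDl, tactDr) IHs IHs'.
by rewrite !tactDl IHr IHr'.
Qed.

Lemma tactC (s t : tensor (restr p A^o) (restr q C^o)) : tact s t = tact t s.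
Proof.
elim/tensor_ind: s => [|a c|s s' IHs IHs']; first by rewrite tact0l tact0r.
  elim/tensor_ind: t => [|a' c'|t t' IHt IHt']; first by rewrite tact0l tact0r.
  - by rewrite !tactE; congr (_ ⊗ _); apply: mulrC.
  - by rewrite tactDl tactDr IHt IHt'.
by rewrite tactDl tactDr IHs IHs'.
Qed.

Definition tensalg_type : Type := tensor (restr p A^o) (restr q C^o).
HB.instance Definition _ := GRing.Zmodule.on tensalg_type.

Definition tensalg_one : tensalg_type := (1 : restr p A^o) ⊗ (1 : restr q C^o).
Definition tensalg_mul (s t : tensalg_type) : tensalg_type := tact s t.

Lemma tensalg_mulA : associative tensalg_mul.
Proof. by move=> r s t; apply: tactA. Qed.
Lemma tensalg_mulC : commutative tensalg_mul.
Proof. exact: tactC. Qed.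
Lemma tensalg_mul1 : left_id tensalg_one tensalg_mul.
Proof. exact: tact1. Qed.
Lemma tensalg_mulDl : left_distributive tensalg_mul +%R.
Proof. by move=> r s t; apply: tactDl. Qed.

HB.instance Definition _ := GRing.Zmodule_isComPzRing.Build tensalg_type
  tensalg_mulA tensalg_mulC tensalg_mul1 tensalg_mulDl.

Definition tensalg : comPzRingType := GRing.ComPzRing.clone tensalg_type _.

Section Module.
Variables (M : lmodType A) (N : lmodType C).

Definition tens2_type : Type := tensor (restr p M) (restr q N).
HB.instance Definition _ := GRing.Zmodule.on tens2_type.

Definition tens2_scale (s : tensalg) (t : tens2_type) : tens2_type := tact s t.

Lemma tens2_scaleA r s t : tens2_scale r (tens2_scale s t) = tens2_scale (r * s) t.
Proof. exact: tactA. Qed.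
Lemma tens2_scale1 : left_id 1 tens2_scale.
Proof. exact: tact1. Qed.
Lemma tens2_scaleDr : right_distributive tens2_scale +%R.
Proof. by move=> s t t'; apply: tactDr. Qed.
Lemma tens2_scaleDl t : {morph tens2_scale^~ t : r s / r + s}.
Proof. by move=> r s; apply: tactDl. Qed.

HB.instance Definition _ := GRing.Zmodule_isLmodule.Build tensalg
  tens2_type tens2_scaleA tens2_scale1 tens2_scaleDr tens2_scaleDl.

Definition tens2 : lmodType tensalg := GRing.Lmodule.clone tensalg tens2_type _.

Lemma tens2Z (s : tensalg) (t : tens2) : s *: t = tact s t.
Proof. by []. Qed.
End Module.

End TensorAlgebra.

Arguments tensalg : simpl never.
Arguments tens2 : simpl never.

Section Extension.
Variables (B E : comPzRingType) (p : {rmorphism B -> E}).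

Section Module.
Variable M : lmodType B.

Definition extend_type : Type := tensor (restr p E^o) M.
HB.instance Definition _ := GRing.Zmodule.on extend_type.

Definition extend_scale (e : E) (t : extend_type) : extend_type :=
  tmap (homothety p E^o e) (lid M) t.

Let scaleE (e : E) (x : restr p E^o) (m : M) :
  extend_scale e (x ⊗ m) = ((e * (x : E)) : restr p E^o) ⊗ m.
Proof. exact: tmapE. Qed.
Let scale0 e : extend_scale e 0 = 0.
Proof. exact: linear0. Qed.

Lemma extend_scaleDr : right_distributive extend_scale +%R.
Proof. by move=> e t u; apply: linearD. Qed.
Lemma extend_scaleA d e t : extend_scale d (extend_scale e t) = extend_scale (d * e) t.
Proof.
elim/tensor_ind: t => [|x m|t u IHt IHu]; first by rewrite !scale0.
- by rewrite !scaleE mulrA.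
- by rewrite !extend_scaleDr IHt IHu.
Qed.
Lemma extend_scale1 : left_id 1 extend_scale.
Proof.
elim/tensor_ind => [|x m|t u IHt IHu]; first by rewrite !scale0.
- by rewrite !scaleE mul1r.
- by rewrite !extend_scaleDr IHt IHu.
Qed.
Lemma extend_scaleDl t : {morph extend_scale^~ t : d e / d + e}.
Proof.
move=> d e; elim/tensor_ind: t => [|x m|t u IHt IHu].
- by rewrite !scale0 addr0.
- by rewrite !scaleE mulrDl; apply: tmulDl.
- by rewrite !extend_scaleDr IHt IHu addrACA.
Qed.

HB.instance Definition _ := GRing.Zmodule_isLmodule.Build E extend_type
  extend_scaleA extend_scale1 extend_scaleDr extend_scaleDl.

(* Extension of scalars E ⊗_B M, an E-module through its left factor. *)
Definition extend : lmodType E := GRing.Lmodule.clone E extend_type _.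

Definition emul (e : E) (m : M) : extend := (e : restr p E^o) ⊗ m.

Lemma emulDl e e' m : emul (e + e') m = emul e m + emul e' m.
Proof. exact: tmulDl. Qed.
Lemma emulZ d e m : d *: emul e m = emul (d * e) m.
Proof. exact: scaleE. Qed.

Lemma extend_ind (P : extend -> Prop) :
  P 0 -> (forall e m, P (emul e m)) -> (forall t u, P t -> P u -> P (t + u)) ->
  forall t, P t.
Proof. exact: (@tensor_ind B (restr p E^o) M). Qed.

(* The two B-module structures on E ⊗_B M coincide. *)
Lemma extendZB (b : B) (t : extend) :
  p b *: t = b *: (t : tensor (restr p E^o) M).
Proof.
elim/extend_ind: t => [|x m|t u IHt IHu].
- by rewrite scaler0; symmetry; apply: (@scaler0 _ (tensor (restr p E^o) M)).
- by rewrite emulZ /emul -tmulZl.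
- by rewrite scalerDr IHt IHu; symmetry; apply: (@scalerDr _ (tensor (restr p E^o) M)).
Qed.

Lemma emul_is_linear e : linear (fun m => (emul e m) : restr p extend).
Proof. by move=> b m m'; rewrite restrZ extendZB; apply: tmul_is_linear. Qed.
Definition emulL e : {linear M -> restr p extend} := mklin (emul_is_linear e).
Lemma emulLE e m : emulL e m = emul e m.
Proof. by []. Qed.

End Module.

Section Hom.
Variables (M M' : lmodType B) (f : {linear M -> M'}).

Definition extend_hom_fun (t : extend M) : extend M' := tmap (lid _) f t.

Lemma extend_hom_is_linear : linear extend_hom_fun.
Proof.
have hD t u : extend_hom_fun (t + u) = extend_hom_fun t + extend_hom_fun u.
  exact: (@linearD _ (tensor (restr p E^o) M)).
have h0 : extend_hom_fun 0 = 0 by exact: (@linear0 _ (tensor (restr p E^o) M)).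
have hE e m : extend_hom_fun (emul e m) = emul e (f m) by exact: tmapE.
move=> e t u; rewrite hD; congr (_ + _).
elim/extend_ind: t => [|x m|t t' IHt IHt']; first by rewrite scaler0 h0 scaler0.
- by rewrite emulZ !hE emulZ.
- by rewrite scalerDr !hD IHt IHt' scalerDr.
Qed.

Definition extend_hom : {linear extend M -> extend M'} := mklin extend_hom_is_linear.

Lemma extend_homE e m : extend_hom (emul e m) = emul e (f m).
Proof. exact: tmapE. Qed.
End Hom.

End Extension.

Arguments extend : simpl never.
Arguments emul {B E} p {M} e m : simpl never.
Arguments emulL {B E} p M e : simpl never.
Arguments extend_hom {B E} p {M M'} f : simpl never.

Section Descent.
Variables (B E : comPzRingType) (p : {rmorphism B -> E}).

Local Notation EB := (restr p E^o).

Section Base.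
Variables M N : lmodType E.

Lemma tens2ZB (b : B) (t : tensor (restr p M) (restr p N)) :
  b *: t = (((p b : EB) ⊗ (1 : EB)) : tensalg p p) *: (t : tens2 p p M N).
Proof.
rewrite tens2Z; elim/tensor_ind: t => [|x y|t u IHt IHu].
- by rewrite tact0r scaler0.
- by rewrite -tmulZl tactE scale1r.
- by rewrite scalerDr IHt IHu tactDr.
Qed.
End Base.

Section Base2.
Variables M N M' N' : lmodType E.
Variable phi : {linear tens2 p p M N -> tens2 p p M' N'}.

Lemma tens2_base_is_linear :
  linear (fun t : tensor (restr p M) (restr p N) =>
            (phi t) : tensor (restr p M') (restr p N')).
Proof. by move=> b t u; rewrite !tens2ZB; apply: linearP. Qed.

(* An (E ⊗_B E)-linear map, seen as a B-linear map. *)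
Definition tens2_base :
  {linear tensor (restr p M) (restr p N) -> tensor (restr p M') (restr p N')} :=
  mklin tens2_base_is_linear.

Lemma tens2_baseE t : tens2_base t = phi t.
Proof. by []. Qed.
End Base2.

Section Cocycle.
Variable N : lmodType E.
Variable phi : {linear tens2 p p N E^o -> tens2 p p E^o N}.

Local Notation NB := (restr p N).

(* The three maps induced by phi between the triple tensor products; phi13 sends
   (n ⊗ e) ⊗ e' to the element obtained from phi (n ⊗ e') by inserting e as
   middle factor. *)
Definition phi12 : {linear tensor (tensor NB EB) EB -> tensor EB (tensor NB EB)} :=
  lcomp (tassoc EB NB EB) (tmap (tens2_base phi) (lid EB)).
Definition phi23 : {linear tensor EB (tensor NB EB) -> tensor EB (tensor EB NB)} :=
  tmap (lid EB) (tens2_base phi).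
Definition phi13 : {linear tensor (tensor NB EB) EB -> tensor EB (tensor EB NB)} :=
  lcomp (tmap (lid EB) (tswap NB EB)) (lcomp phi12 (lcomp (tassocV NB EB EB)
    (lcomp (tmap (lid NB) (tswap EB EB)) (tassoc NB EB EB)))).

Definition cocycle := forall t, phi23 (phi12 t) = phi13 t.
End Cocycle.

(* (N, phi) with N an E-module and phi : N ⊗_B E -> E ⊗_B N an isomorphism of
   (E ⊗_B E)-modules. *)
Record descent_datum := DescentDatum {
  dd_mod : lmodType E;
  dd_iso : {linear tens2 p p dd_mod E^o -> tens2 p p E^o dd_mod};
  dd_bij : bijective dd_iso;
  dd_cocycle : cocycle dd_iso
}.

Definition dd_compatible (D D' : descent_datum)
    (h : {linear dd_mod D -> dd_mod D'}) :=
  forall t : tensor (restr p (dd_mod D)) EB,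
    dd_iso D' (tmap (restr_hom p h) (lid EB) t) =
    tmap (lid EB) (restr_hom p h) (dd_iso D t).

Record descent_hom (D D' : descent_datum) := DescentHom {
  dh_map : {linear dd_mod D -> dd_mod D'};
  dh_compatible : dd_compatible dh_map
}.

Lemma descent_hom_ext D D' (h k : descent_hom D D') :
  dh_map h =1 dh_map k -> h = k.
Proof.
case: h k => [h ch] [k ck] /= /linear_ext hk; rewrite hk in ch *.
by rewrite (Prop_irrelevance ch ck).
Qed.

Lemma descent_id_compatible (D : descent_datum) :
  @dd_compatible D D (lid (dd_mod D)).
Proof. by move=> t; rewrite !tmap_id. Qed.
Definition descent_id D : descent_hom D D := DescentHom (@descent_id_compatible D).

Lemma descent_comp_compatible (D1 D2 D3 : descent_datum)
    (k : descent_hom D2 D3) (h : descent_hom D1 D2) :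
  @dd_compatible D1 D3 (lcomp (dh_map k) (dh_map h)).
Proof.
case: k h => [k ck] [h ch] /= t.
rewrite (tmap_comp (f' := restr_hom p k) (f := restr_hom p h)
  (g' := lid EB) (g := lid EB)) //.
rewrite [RHS](tmap_comp (g' := restr_hom p k) (g := restr_hom p h)
  (f' := lid EB) (f := lid EB)) //.
by rewrite ck ch.
Qed.
Definition descent_comp D1 D2 D3 (k : descent_hom D2 D3) (h : descent_hom D1 D2) :
  descent_hom D1 D3 := DescentHom (descent_comp_compatible k h).

Section Canonical.
Variable M : lmodType B.
Local Notation LB := (restr p (extend p M)).

Lemma tensor_extend_ind (P : tensor LB EB -> Prop) :
  P 0 -> (forall e m e', P ((emul p e m : LB) ⊗ e')) ->
  (forall t u, P t -> P u -> P (t + u)) -> forall t, P t.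
Proof.
move=> P0 Pm PD; apply: tensor_ind => // x e'.
elim/extend_ind: x => [|e m|t u Pt Pu]; first by rewrite tmul0l.
- exact: Pm.
- by rewrite tmulDl; apply: PD.
Qed.

Definition can_in (t : LB) (e : EB) : tensor EB LB :=
  tmap (lid EB) (emulL p M e) t.

Let can_inE e m e' : can_in (emul p e m) e' = (e : EB) ⊗ (emul p e' m : LB).
Proof. exact: tmapE. Qed.
Let can_in0 e : can_in 0 e = 0.
Proof. exact: (@linear0 _ (tensor EB M)). Qed.
Let can_inD e t u : can_in (t + u) e = can_in t e + can_in u e.
Proof. exact: (@linearD _ (tensor EB M)). Qed.

Lemma can_linl e : linear (can_in^~ e).
Proof.
move=> b t u; rewrite can_inD restrZ extendZB; congr (_ + _).
exact: (@linearZ _ (tensor EB M)).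
Qed.
Lemma can_linr t : linear (can_in t).
Proof.
move=> b e e'; elim/extend_ind: t => [|x m|t u IHt IHu].
- by rewrite !can_in0 scaler0 addr0.
- rewrite !can_inE emulDl restrZ -emulZ -tmulZr -tmulDr.
  by [].
- by rewrite !can_inD IHt IHu scalerDr addrACA.
Qed.

Definition can_isoB : {linear tensor LB EB -> tensor EB LB} :=
  tlift can_linl can_linr.

Lemma can_isoBE e m e' :
  can_isoB ((emul p e m : LB) ⊗ e') = (e : EB) ⊗ (emul p e' m : LB).
Proof. by rewrite /can_isoB tliftE can_inE. Qed.

Lemma can_iso_is_linear :
  linear (fun t : tens2 p p (extend p M) E^o =>
            (can_isoB t) : tens2 p p E^o (extend p M)).
Proof.
move=> s t u; rewrite -[RHS]/(s *: _ + _) (linearD can_isoB); congr (_ + _).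
rewrite !tens2Z; elim/tensor_ind: s => [|a c|s s' IHs IHs'].
- by rewrite !tact0l linear0.
- elim/tensor_extend_ind: t => [|e m e'|t t' IHt IHt'].
  + by rewrite tact0r linear0 tact0r.
  + by rewrite can_isoBE !tactE !emulZ can_isoBE.
  + by rewrite tactDr !linearD IHt IHt' tactDr.
- by rewrite !tactDl linearD IHs IHs'.
Qed.

(* The canonical descent datum: (e ⊗ m) ⊗ e' is sent to e ⊗ (e' ⊗ m). *)
Definition can_iso : {linear tens2 p p (extend p M) E^o -> tens2 p p E^o (extend p M)}
  := mklin can_iso_is_linear.

Lemma can_isoBK (t : tensor LB EB) :
  tswap _ _ (can_isoB (tswap _ _ (can_isoB t))) = t.
Proof.
elim/tensor_extend_ind: t => [|e m e'|t u IHt IHu]; first by rewrite !linear0.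
- by rewrite can_isoBE tswapE can_isoBE tswapE.
- by rewrite !linearD IHt IHu.
Qed.

Lemma can_iso_bij : bijective can_iso.
Proof.
exists (fun t : tensor EB LB => tswap _ _ (can_isoB (tswap _ _ t))).
  exact: can_isoBK.
by move=> t; apply: (can_inj (@tswapK _ EB LB)); apply: can_isoBK.
Qed.

Lemma can_iso_cocycle : cocycle can_iso.
Proof.
have cE e m e' :
    tens2_base can_iso ((emul p e m : LB) ⊗ e') = (e : EB) ⊗ (emul p e' m : LB).
  exact: can_isoBE.
move=> t; rewrite /phi13 /phi23 /phi12 !lcompE.
elim/tensor_ind: t => [|x e2|t u IHt IHu]; first by rewrite !linear0.
- elim/tensor_extend_ind: x => [|e m e1|x x' IHx IHx'].
  + by rewrite tmul0l !linear0.
  + by rewrite !(tmapE, tassocE, tassocVE, tswapE, cE, lidE).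
  + by rewrite tmulDl !linearD IHx IHx'.
- by rewrite !linearD IHt IHu.
Qed.

Definition can_datum : descent_datum := DescentDatum can_iso_bij can_iso_cocycle.

End Canonical.

Section CanonicalHom.
Variables (M M' : lmodType B) (f : {linear M -> M'}).

Lemma can_hom_compatible :
  @dd_compatible (can_datum M) (can_datum M') (extend_hom p f).
Proof.
have hE e m : restr_hom p (extend_hom p f) (emul p e m) = emul p e (f m).
  exact: extend_homE.
move=> t; change (can_isoB M' (tmap (restr_hom p (extend_hom p f)) (lid EB) t) =
  tmap (lid EB) (restr_hom p (extend_hom p f)) (can_isoB M t)).
elim/tensor_extend_ind: t => [|e m e'|t u IHt IHu]; first by rewrite !linear0.
- by rewrite can_isoBE (tmapE (restr_hom p (extend_hom p f))) hE (tmapE (lid EB)) hE can_isoBE.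
- by rewrite !linearD IHt IHu.
Qed.

Definition can_hom : descent_hom (can_datum M) (can_datum M') :=
  @DescentHom (can_datum M) (can_datum M') (extend_hom p f) can_hom_compatible.
End CanonicalHom.

End Descent.

Record category := Category {
  obj :> Type;
  hom : obj -> obj -> Type;
  idm : forall x, hom x x;
  compm : forall x y z, hom y z -> hom x y -> hom x z;
  compm1 : forall x y (f : hom x y), compm f (idm x) = f;
  comp1m : forall x y (f : hom x y), compm (idm y) f = f;
  compmA : forall x y z w (f : hom z w) (g : hom y z) (h : hom x y),
    compm f (compm g h) = compm (compm f g) h
}.

Arguments idm {c} x.
Arguments compm {c x y z} f g.

Definition monomorphism (C : category) (x y : C) (f : hom x y) :=
  forall z (g h : hom z x), compm f g = compm f h -> g = h.

Definition isomorphism (C : category) (x y : C) (f : hom x y) :=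
  exists g : hom y x, compm g f = idm x /\ compm f g = idm y.

Record functor (C D : category) := Functor {
  fobj :> C -> D;
  fhom : forall x y, hom x y -> hom (fobj x) (fobj y);
  fhom1 : forall x, fhom (idm x) = idm (fobj x);
  fhomM : forall x y z (f : hom y z) (g : hom x y),
    fhom (compm f g) = compm (fhom f) (fhom g)
}.

Arguments fhom {C D} _ {x y} _.

Definition id_functor (C : category) : functor C C :=
  @Functor C C id (fun _ _ f => f) (fun _ => erefl) (fun _ _ _ _ _ => erefl).

Section CompFunctor.
Variables (C D E : category) (G : functor D E) (F : functor C D).
Lemma comp_fhom1 x : fhom G (fhom F (idm x)) = idm (G (F x)).
Proof. by rewrite !fhom1. Qed.
Lemma comp_fhomM x y z (f : hom y z) (g : hom x y) :
  fhom G (fhom F (compm f g)) = compm (fhom G (fhom F f)) (fhom G (fhom F g)).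
Proof. by rewrite !fhomM. Qed.
Definition comp_functor : functor C E :=
  @Functor C E (fun x => G (F x)) (fun _ _ f => fhom G (fhom F f))
    comp_fhom1 comp_fhomM.
End CompFunctor.

Definition naturally_isomorphic (C D : category) (F G : functor C D) :=
  exists eta : forall x, hom (F x) (G x),
    (forall x, isomorphism (eta x)) /\
    (forall x y (f : hom x y), compm (eta y) (fhom F f) = compm (fhom G f) (eta x)).

Definition equivalence (C D : category) (F : functor C D) :=
  exists G : functor D C,
    naturally_isomorphic (id_functor C) (comp_functor G F) /\
    naturally_isomorphic (comp_functor F G) (id_functor D).

Section ModCat.
Variable R : comPzRingType.

Lemma lcomp1 (M N : lmodType R) (f : {linear M -> N}) : lcomp f (lid M) = f.
Proof. exact: linear_ext. Qed.
Lemma lcomp1l (M N : lmodType R) (f : {linear M -> N}) : lcomp (lid N) f = f.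
Proof. exact: linear_ext. Qed.
Lemma lcompA (M N P Q : lmodType R) (h : {linear P -> Q})
    (g : {linear N -> P}) (f : {linear M -> N}) :
  lcomp h (lcomp g f) = lcomp (lcomp h g) f.
Proof. exact: linear_ext. Qed.

Definition Mod : category :=
  @Category (lmodType R) (fun M N => {linear M -> N})
    (@lid R) (@lcomp R) lcomp1 lcomp1l lcompA.
End ModCat.

Definition pure (B : comPzRingType) (M M' : lmodType B) (f : {linear M -> M'}) :=
  forall N : lmodType B,
    @monomorphism (Mod B) (tensor N M) (tensor N M') (tmap (lid N) f).

Section DesCat.
Variables (B E : comPzRingType) (p : {rmorphism B -> E}).

Lemma descent_comp1 (D D' : descent_datum p) (h : descent_hom D D') :
  descent_comp h (descent_id D) = h.
Proof. exact: descent_hom_ext. Qed.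
Lemma descent_1comp (D D' : descent_datum p) (h : descent_hom D D') :
  descent_comp (descent_id D') h = h.
Proof. exact: descent_hom_ext. Qed.
Lemma descent_compA (D1 D2 D3 D4 : descent_datum p) (h : descent_hom D3 D4)
    (g : descent_hom D2 D3) (f : descent_hom D1 D2) :
  descent_comp h (descent_comp g f) = descent_comp (descent_comp h g) f.
Proof. exact: descent_hom_ext. Qed.

Definition Des : category :=
  @Category (descent_datum p) (@descent_hom B E p) (@descent_id B E p)
    (@descent_comp B E p) descent_comp1 descent_1comp descent_compA.

Lemma can_hom1 (M : lmodType B) : can_hom p (lid M) = descent_id (can_datum p M).
Proof.
apply: descent_hom_ext; apply: extend_ind => [|e m|t u IHt IHu].
- by rewrite !linear0.
- exact: extend_homE.
- by rewrite !linearD IHt IHu.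
Qed.

Lemma can_homM (M N P : lmodType B) (g : {linear N -> P}) (f : {linear M -> N}) :
  can_hom p (lcomp g f) = descent_comp (can_hom p g) (can_hom p f).
Proof.
apply: descent_hom_ext; apply: extend_ind => [|e m|t u IHt IHu].
- by rewrite !linear0.
- change (extend_hom p (lcomp g f) (emul p e m) =
    extend_hom p g (extend_hom p f (emul p e m))).
  by rewrite !extend_homE.
- by rewrite !linearD IHt IHu.
Qed.

(* K_p : M |-> E ⊗_B M with its canonical descent datum. *)
Definition comparison_functor : functor (Mod B) Des :=
  @Functor (Mod B) Des (can_datum p) (fun _ _ f => can_hom p f) can_hom1 can_homM.

Definition effective_descent := equivalence comparison_functor.

End DesCat.

(* Main.v *)
(* An equivalence K_p is faithful. If 1 ⊗ x = 0 in E ⊗ M, then b |-> b x and 0 have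
   the same extension of scalars, so x = 0; hence M -> E ⊗ M is injective for every
   M, which is purity of p.

   Conversely, purity lets finite systems of linear equations over B-modules be
   solved after applying E ⊗ - (look at the class of the right-hand side in the
   cokernel). A descent datum on N amounts to a coaction theta : N -> E ⊗ N, and if
   theta x = sum_i e_i ⊗ y_i, then the system "theta z_i = 1 ⊗ z_i and
   sum_i e_i z_i = x" has the solution z_i := theta y_i over E. So N is generated
   over E by the module M of its invariants, that is, E ⊗ M -> N is onto; the same
   argument inside its kernel shows that the kernel is generated by invariants
   1 ⊗ m, and these are zero. *)
From HB Require Import structures.
Require Import Defs.
From mathcomp Require Import all_boot all_algebra generic_quotient.
From mathcomp Require Import boolp.

Set Implicit Arguments.
Unset Strict Implicit.
Unset Printing Implicit Defensive.
Import GRing.Theory.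
Local Open Scope ring_scope.
Local Open Scope quotient_scope.

(** * Submodules and quotient modules *)

Record submodule (R : pzRingType) (V : lmodType R) := Submodule {
  smem :> V -> Prop;
  smem0 : smem 0;
  smemP : forall a u v, smem u -> smem v -> smem (a *: u + v)
}.

Section Submodules.
Variables (R : pzRingType) (V : lmodType R) (S : submodule V).

Lemma smemD u v : S u -> S v -> S (u + v).
Proof. by move=> Su Sv; rewrite -[u]scale1r; apply: smemP. Qed.
Lemma smemZ a u : S u -> S (a *: u).
Proof. by move=> Su; rewrite -[_ *: _]addr0; apply: smemP => //; apply: smem0. Qed.
Lemma smemN u : S u -> S (- u).
Proof. by rewrite -scaleN1r; apply: smemZ. Qed.

Definition sub_pred : {pred V} := [pred x | `[< S x >]].

Lemma sub_pred_closed : subsemimod_closed sub_pred.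
Proof.
split; first split.
- by apply/asboolP; apply: smem0.
- by move=> u v /asboolP Su /asboolP Sv; apply/asboolP; apply: smemD.
- by move=> a v /asboolP Sv; apply/asboolP; apply: smemZ.
Qed.

Definition sub_type := {x : V | x \in sub_pred}.
HB.instance Definition _ := [isSub of sub_type for sval].
HB.instance Definition _ := [Choice of sub_type by <:].
HB.instance Definition _ :=
  GRing.SubChoice_isSubLmodule.Build R V sub_pred sub_type sub_pred_closed.

Definition submod : lmodType R := GRing.Lmodule.clone R sub_type _.

Lemma sub_val_is_linear : linear (fun x : submod => sval x : V).
Proof. by []. Qed.
Definition sub_val : {linear submod -> V} := mklin sub_val_is_linear.

Lemma sub_valP (x : submod) : S (sub_val x).
Proof. exact/asboolP/(svalP x). Qed.
Lemma sub_val_inj : injective sub_val.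
Proof. exact: val_inj. Qed.

Definition mksub (x : V) (Sx : S x) : submod := exist _ x (asboolT Sx).
Lemma mksubE x (Sx : S x) : sub_val (mksub Sx) = x.
Proof. by []. Qed.

Section Corestriction.
Variables (U : lmodType R) (f : {linear U -> V}).
Hypothesis fS : forall x, S (f x).
Lemma corestr_is_linear : linear (fun x => mksub (fS x)).
Proof. by move=> a x y; apply: sub_val_inj; rewrite [RHS]linearP; apply: linearP. Qed.
Definition corestr : {linear U -> submod} := mklin corestr_is_linear.
Lemma corestrE x : sub_val (corestr x) = f x.
Proof. by []. Qed.
End Corestriction.

Definition quot_rel : rel V := fun x y => `[< S (x - y) >].
Lemma quot_relP : equiv_class_of quot_rel.
Proof.
split=> [x|x y|y x z]; first by apply/asboolP; rewrite subrr; apply: smem0.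
  by apply/asboolP/asboolP => /smemN; rewrite opprB.
move=> /asboolP xy /asboolP yz; apply/asboolP.
by rewrite -[x](subrK y) -addrA; apply: smemD.
Qed.
Canonical quot_equiv := EquivRelPack quot_relP.

Definition quot_type := {eq_quot quot_equiv}.
HB.instance Definition _ := Choice.on quot_type.
HB.instance Definition _ := EqQuotient.on quot_type.

Definition qclass (x : V) : quot_type := \pi_quot_type x.

Lemma qclassP x y : qclass x = qclass y <-> S (x - y).
Proof.
split=> [/eqmodP /asboolP //|xy].
by apply/eqmodP; apply/asboolP.
Qed.
Lemma qclassK (u : quot_type) : qclass (repr u) = u.
Proof. exact: reprK. Qed.
Lemma repr_qclass x : S (repr (qclass x) - x).
Proof. by apply/qclassP; rewrite qclassK. Qed.

Definition qadd (u v : quot_type) := qclass (repr u + repr v).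
Definition qscale a (u : quot_type) := qclass (a *: repr u).
Definition qopp (u : quot_type) := qclass (- repr u).

Lemma qaddE x y : qadd (qclass x) (qclass y) = qclass (x + y).
Proof. by apply/qclassP; rewrite opprD addrACA; apply: smemD; apply: repr_qclass. Qed.
Lemma qscaleE a x : qscale a (qclass x) = qclass (a *: x).
Proof. by apply/qclassP; rewrite -scalerBr; apply: smemZ; apply: repr_qclass. Qed.
Lemma qoppE x : qopp (qclass x) = qclass (- x).
Proof. by apply/qclassP; rewrite -opprD; apply: smemN; apply: repr_qclass. Qed.

Lemma qind (P : quot_type -> Prop) : (forall x, P (qclass x)) -> forall u, P u.
Proof. by move=> Pq u; rewrite -(qclassK u). Qed.

Lemma qaddA : associative qadd.
Proof. by do 3!elim/qind=> ?; rewrite !qaddE addrA. Qed.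
Lemma qaddC : commutative qadd.
Proof. by do 2!elim/qind=> ?; rewrite !qaddE addrC. Qed.
Lemma qadd0 : left_id (qclass 0) qadd.
Proof. by elim/qind=> ?; rewrite !qaddE add0r. Qed.
Lemma qaddN : left_inverse (qclass 0) qopp qadd.
Proof. by elim/qind=> ?; rewrite qoppE !qaddE addNr. Qed.
HB.instance Definition _ := GRing.isZmodule.Build quot_type qaddA qaddC qadd0 qaddN.

Lemma qscaleA a b u : qscale a (qscale b u) = qscale (a * b) u.
Proof. by elim/qind: u => ?; rewrite !qscaleE scalerA. Qed.
Lemma qscale1 : left_id 1 qscale.
Proof. by elim/qind=> ?; rewrite !qscaleE scale1r. Qed.
Lemma qscaleDr : right_distributive qscale +%R.
Proof.
move=> a; elim/qind=> x; elim/qind=> y.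
by rewrite -[_ + _]/(qadd _ _) -[RHS]/(qadd _ _) qaddE !qscaleE qaddE scalerDr.
Qed.
Lemma qscaleDl u : {morph qscale^~ u : a b / a + b}.
Proof. by elim/qind: u => ? a b; rewrite -[RHS]/(qadd _ _) !qscaleE qaddE scalerDl. Qed.
HB.instance Definition _ := GRing.Zmodule_isLmodule.Build R quot_type
  qscaleA qscale1 qscaleDr qscaleDl.

Definition quotmod : lmodType R := GRing.Lmodule.clone R quot_type _.

Lemma quot_proj_is_linear : linear (fun x : V => qclass x : quotmod).
Proof. by move=> a x y; rewrite -[RHS]/(qadd (qscale a _) _) qscaleE qaddE. Qed.
Definition quot_proj : {linear V -> quotmod} := mklin quot_proj_is_linear.

Lemma quot_proj_eq0 x : quot_proj x = 0 <-> S x.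
Proof. by rewrite -[0]/(qclass 0) mklinE qclassP subr0. Qed.

End Submodules.

Section LinearKernels.
Variables (R : pzRingType) (U V : lmodType R) (f : {linear U -> V}).

Lemma ker_sub_closed a u v : f u = 0 -> f v = 0 -> f (a *: u + v) = 0.
Proof. by move=> fu fv; rewrite linearP fu fv scaler0 addr0. Qed.
Definition ker_sub : submodule U := Submodule (linear0 f) ker_sub_closed.

Lemma img_sub_closed a (u v : V) : (exists x, f x = u) -> (exists x, f x = v) ->
  exists x, f x = a *: u + v.
Proof. by move=> [x <-] [y <-]; exists (a *: x + y); rewrite linearP. Qed.
Definition img_sub : submodule V :=
  @Submodule R V (fun v => exists x, f x = v) (ex_intro _ 0 (linear0 f)) img_sub_closed.
End LinearKernels.

(** Allows [invariant_span], which speaks of a submodule, to be applied to the whole module. *)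
Definition full_sub (R : pzRingType) (U : lmodType R) : submodule U :=
  @Submodule R U (fun=> True) I (fun _ _ _ _ _ => I).

Lemma linear_inj (R : pzRingType) (U V : lmodType R) (f : {linear U -> V}) :
  (forall x, f x = 0 -> x = 0) -> injective f.
Proof.
move=> f0 x y fxy; apply/eqP; rewrite -subr_eq0; apply/eqP/f0.
by rewrite linearB fxy subrr.
Qed.

(** * Right exactness of the tensor product *)

Section TensorExactness.
Variable B : comPzRingType.

Lemma tensor_sum (M N : lmodType B) (t : tensor M N) :
  exists k (x : 'I_k -> M) (y : 'I_k -> N), t = \sum_(i < k) x i ⊗ y i.
Proof.
have [s ->] : exists s, t = tclassL s.
  by exists (repr (t : tensor_type M N)); rewrite /tclassL tclassK.
exists (size s), (fun i => (tnth (in_tuple s) i).1), (fun i => (tnth (in_tuple s) i).2).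
by rewrite tclass_sum big_tnth.
Qed.

Lemma tmap_lcomp (X M N P : lmodType B) (g : {linear N -> P}) (f : {linear M -> N})
    (t : tensor X M) :
  tmap (lid X) (lcomp g f) t = tmap (lid X) g (tmap (lid X) f t).
Proof. exact: tmap_comp. Qed.

Section RightExact.
Variables (X M N : lmodType B) (g : {linear M -> N}).
Hypothesis g_surj : forall y, exists x, g x = y.

Let I : submodule (tensor X M) := img_sub (tmap (lid X) (sub_val (ker_sub g))).
(** A chosen section of [g]; it need not be linear, but it is linear modulo the kernel of [g], which
    suffices in the quotient by [I]. *)
Let s y := projT1 (cid (g_surj y)).
Let sK y : g (s y) = y. Proof. exact: projT2 (cid (g_surj y)). Qed.

Let proj_ker (x : X) (u v : M) : g u = g v -> quot_proj I (x ⊗ u) = quot_proj I (x ⊗ v).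
Proof.
move=> guv; apply/eqP; rewrite -subr_eq0 -linearB; apply/eqP/quot_proj_eq0.
have Kuv : ker_sub g (u - v) by rewrite /= linearB guv subrr.
exists (x ⊗ mksub Kuv); rewrite tmapE mksubE lidE.
by rewrite tmulDr -[- v]scaleN1r tmulZr scaleN1r.
Qed.

Let linl y : linear (fun x : X => quot_proj I (x ⊗ s y)).
Proof. by move=> a x x'; rewrite tmulDl tmulZl linearP. Qed.
Let linr x : linear (fun y : N => quot_proj I (x ⊗ s y)).
Proof.
move=> a y y'; rewrite -linearP -tmulZr -tmulDr; apply: proj_ker.
by rewrite linearP !sK.
Qed.

(** Modulo [I], the image of X ⊗ ker g, the element x ⊗ s y does not depend on the chosen preimage
    of y. It is therefore bilinear and induces [h] on X ⊗ N. The projection modulo [I] is [h] after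
    X ⊗ g, so whatever X ⊗ g kills lies in [I]. *)
Lemma tensor_right_exact (t : tensor X M) : tmap (lid X) g t = 0 ->
  exists u : tensor X (submod (ker_sub g)), tmap (lid X) (sub_val (ker_sub g)) u = t.
Proof.
pose h : {linear tensor X N -> quotmod I} := tlift linl linr.
have hE : lcomp h (tmap (lid X) g) =1 quot_proj I.
  apply: tensor_ext => x y; rewrite lcompE tmapE /h tliftE lidE.
  by apply: proj_ker; rewrite sK.
by move=> gt0; apply/(quot_proj_eq0 I); rewrite -hE lcompE gt0 linear0.
Qed.
End RightExact.

End TensorExactness.

(** * Monomorphisms and isomorphisms of modules *)

Section Monomorphisms.
Variable R : comPzRingType.

(** An element x of U is the same as the map a |-> a x from the free module [R^o], so a monomorphism
    separates elements. *)
Lemma mono_inj (U V : lmodType R) (f : {linear U -> V}) :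
  @monomorphism (Mod R) U V f <-> injective f.
Proof.
split=> [fmono x y fxy | finj W g h fgh].
- have scl z : linear (fun a : R^o => a *: z : U).
    by move=> a b c; rewrite scalerDl -scalerA.
  have /(congr1 (fun k : {linear R^o -> U} => k 1)) : mklin (scl x) = mklin (scl y).
    by apply: fmono; apply: linear_ext => a; rewrite !lcompE !mklinE !linearZ /= fxy.
  by rewrite !mklinE !scale1r.
- apply: linear_ext => x; apply: finj.
  exact: (congr1 (fun k : {linear W -> V} => k x) fgh).
Qed.

Lemma bij_iso (U V : lmodType R) (f : {linear U -> V}) :
  injective f -> (forall y, exists x, f x = y) -> @isomorphism (Mod R) U V f.
Proof.
move=> finj fsurj; pose g y := projT1 (cid (fsurj y)).
have gK y : f (g y) = y by exact: projT2 (cid (fsurj y)).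
have gL : linear g by move=> a u v; apply: finj; rewrite linearP !gK.
exists (mklin gL); split; apply: linear_ext => x; last exact: gK.
by apply: finj; apply: gK.
Qed.
End Monomorphisms.

(** * Purity and systems of linear equations *)

Section Purity.
Variables (B E : comPzRingType) (p : {rmorphism B -> E}).
Local Notation EB := (restr p E^o).
Local Notation one := (1 : EB).

(** The action identifies M ⊗ B with M; under this identification, and up to a swap, M ⊗ p becomes x
    |-> 1 ⊗ x. *)
Lemma pure_algmap : pure (algmap p) <->
  forall (M : lmodType B) (x : M), one ⊗ x = 0 -> x = 0.
Proof.
have scl (M : lmodType B) (b : B^o) : linear (fun x : M => (b : B) *: x).
  by move=> a x y; rewrite scalerDr !scalerA mulrC.
have scr (M : lmodType B) (x : M) : linear (fun b : B^o => (b : B) *: x).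
  by move=> a b c; rewrite scalerDl -scalerA.
pose act (M : lmodType B) := tlift (@scl M) (@scr M).
have act1 (M : lmodType B) (x : M) : act M (x ⊗ (1 : B^o)) = x.
  by rewrite /act tliftE; apply: scale1r.
have actK (M : lmodType B) t : act M t ⊗ (1 : B^o) = t.
  elim/tensor_ind: t => [|x b|t u IHt IHu]; first by rewrite linear0 tmul0l.
  - rewrite /act tliftE tmulZl -tmulZr; congr (_ ⊗ _); exact: mulr1.
  - by rewrite linearD tmulDl IHt IHu.
have algE (M : lmodType B) t :
    tmap (lid M) (algmap p) t = tswap _ _ (one ⊗ act M t).
  by rewrite -{1}(actK _ t) tmapE tswapE lidE algmapE rmorph1.
split=> [ppure M x x0 | H M].
- have := ppure M; rewrite mono_inj => inj.
  have : x ⊗ (1 : B^o) = 0.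
    by apply: inj; rewrite linear0 algE act1 x0 linear0.
  by move/(congr1 (act M)); rewrite linear0 act1.
- rewrite mono_inj; apply: linear_inj => t; rewrite algE => t0.
  have /H at0 : one ⊗ act M t = 0.
    by rewrite -[LHS]tswapK t0 linear0.
  by rewrite -(actK _ t) at0 tmul0l.
Qed.

Section System.
Hypothesis ppure : pure (algmap p).
Variables (A C Y : lmodType B) (c : {linear A -> C}) (k : nat).
Variable f : 'I_k -> {linear A -> Y}.

Let Z : lmodType B := ({ffun 'I_k -> C} * Y)%type.
Let sol z := exists a : 'I_k -> A,
  z = ([ffun i => c (a i)], \sum_i f i (a i)) :> Z.
Let sol0 : sol 0.
Proof.
exists (fun=> 0); congr (_, _).
  by apply/ffunP=> i; rewrite !ffunE linear0.
by rewrite big1 // => i _; rewrite linear0.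
Qed.
Let solP b u v : sol u -> sol v -> sol (b *: u + v).
Proof.
move=> [x ->] [y ->]; exists (fun i => b *: x i + y i); congr (_, _).
  by apply/ffunP=> i; rewrite !ffunE linearP.
rewrite -[LHS]/(b *: (\sum_i f i (x i)) + \sum_i f i (y i)) scaler_sumr -big_split.
by apply: eq_bigr => i _; rewrite linearP.
Qed.
Let S : submodule Z := Submodule sol0 solP.

Let in1_lin i : linear (fun x : C => ([ffun j => if j == i then x else 0], 0) : Z).
Proof.
move=> b x y; congr (_, _); last by rewrite -[RHS]/(b *: 0 + 0) scaler0 addr0.
by apply/ffunP=> j; rewrite !ffunE; case: (j == i) => //; rewrite scaler0 addr0.
Qed.
Let in1 i : {linear C -> Z} := mklin (in1_lin i).
Let in2_lin : linear (fun y : Y => (0, y) : Z).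
Proof.
by move=> b x y; congr (_, _); rewrite -[RHS]/(b *: 0 + 0) scaler0 addr0.
Qed.
Let in2 : {linear Y -> Z} := mklin in2_lin.

(** Witnessed by the family equal to x at i and zero elsewhere. In the quotient by [S] it turns the
    image of [f i] into minus the image of [c]. *)
Let in_sol i x : S (in1 i (c x) + in2 (f i x)).
Proof.
exists (fun j => if j == i then x else 0); congr (_, _).
  by apply/ffunP=> j; rewrite !ffunE addr0; case: (j == i) => //; rewrite linear0.
rewrite add0r (bigD1 i) //= eqxx big1 ?addr0 // => j /negbTE ->.
exact: linear0.
Qed.

(* The conclusion says that (0, y) vanishes in the cokernel of
   a |-> ((c a_i)_i, sum_i f_i a_i); by purity this may be
   checked after applying E ⊗ -, where the t i give a preimage. *)
Lemma pure_system (y : Y) (t : 'I_k -> tensor EB A) :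
  (forall i, tmap (lid EB) c (t i) = 0) ->
  \sum_i tmap (lid EB) (f i) (t i) = one ⊗ y ->
  exists a : 'I_k -> A, (forall i, c (a i) = 0) /\ \sum_i f i (a i) = y.
Proof.
move=> ct ft; pose q := quot_proj S.
have qin i u : tmap (lid EB) (lcomp q in2) (tmap (lid EB) (f i) u) =
    - tmap (lid EB) (lcomp q (in1 i)) (tmap (lid EB) c u).
  elim/tensor_ind: u => [|e x|u v IHu IHv]; first by rewrite !linear0.
  - rewrite !tmapE !lidE; apply/eqP; rewrite -addr_eq0 -tmulDr !lcompE -linearD addrC.
    by rewrite (quot_proj_eq0 S _).2 ?tmul0r //; apply: in_sol.
  - by rewrite !linearD IHu IHv.
have : one ⊗ q (in2 y) = 0.
  rewrite -[q _]lcompE -[one]lidE -tmapE -ft linear_sum big1 // => i _.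
  by rewrite qin ct !linear0.
move/(pure_algmap.1 ppure)/quot_proj_eq0 => [a [/ffunP ca fa]]; exists a.
by split=> // i; have := ca i; rewrite !ffunE.
Qed.
End System.

End Purity.

(** * Coactions and their invariants *)

Section Comodules.
Variables (B E : comPzRingType) (p : {rmorphism B -> E}).
Local Notation EB := (restr p E^o).
Local Notation one := (1 : EB).

Definition unit_map (M : lmodType B) : {linear M -> tensor EB M} :=
  mklin (@tmul_is_linear B EB M one).

Lemma unit_mapE M x : unit_map M x = one ⊗ x.
Proof. by []. Qed.

Section Action.
Variable N : lmodType E.
Local Notation NB := (restr p N).

Lemma scale_linl (x : NB) : linear (fun e : EB => ((e : E) *: (x : N)) : NB).
Proof. by move=> b e e'; rewrite scalerDl -scalerA. Qed.
Lemma scale_linr (e : EB) : linear (fun x : NB => ((e : E) *: (x : N)) : NB).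
Proof. exact: homothety_is_linear. Qed.
Definition scale_map : {linear tensor EB NB -> NB} := tlift scale_linl scale_linr.

Lemma scale_mapE e x : scale_map (e ⊗ x) = (e : E) *: (x : N).
Proof. exact: tliftE. Qed.

(* e ⊗ (e' ⊗ x) is sent to e' ⊗ e x. *)
Definition scale_inner : {linear tensor EB (tensor EB NB) -> tensor EB NB} :=
  lcomp (tmap (lid EB) scale_map) (lcomp (tassoc EB EB NB)
    (lcomp (tmap (tswap EB EB) (lid NB)) (tassocV EB EB NB))).

Lemma scale_innerE e w :
  scale_inner (e ⊗ w) = tmap (lid EB) (homothety p N e) w.
Proof.
elim/tensor_ind: w => [|e' x|u v IHu IHv]; first by rewrite tmul0r !linear0.
- by rewrite /scale_inner !lcompE tassocVE !tmapE tswapE tassocE tmapE scale_mapE.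
- by rewrite tmulDr !linearD IHu IHv.
Qed.

Lemma scale_inner_unit t :
  scale_inner (tmap (lid EB) (unit_map NB) t) = one ⊗ scale_map t.
Proof.
elim/tensor_ind: t => [|e x|u v IHu IHv]; first by rewrite !linear0 tmul0r.
- by rewrite tmapE unit_mapE lidE scale_innerE tmapE lidE homothetyE scale_mapE.
- by rewrite !linearD tmulDr IHu IHv.
Qed.
End Action.

Section Coaction.
Variables (N : lmodType E) (theta : {linear restr p N -> tensor EB (restr p N)}).
Local Notation NB := (restr p N).

(** The comultiplication of the comonad E ⊗ - inserts 1 between the two factors, which is E ⊗
    [unit_map]. *)
Definition coassociative := forall x,
  tmap (lid EB) theta (theta x) = tmap (lid EB) (unit_map NB) (theta x).
Definition counital := forall x, scale_map N (theta x) = x.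

Lemma invariant_closed b (x y : NB) : theta x = one ⊗ x -> theta y = one ⊗ y ->
  theta (b *: x + y) = one ⊗ (b *: x + y).
Proof. by move=> tx ty; rewrite linearP tx ty -tmulZr -tmulDr. Qed.
Lemma invariant0 : theta 0 = one ⊗ 0.
Proof. by rewrite linear0 tmul0r. Qed.
Definition invariants : submodule NB := Submodule invariant0 invariant_closed.

(** Write theta x as a sum of e_i ⊗ y_i with y_i in [K], and apply [pure_system] with unknowns in
    [K]: they must be invariant and have e_i-combination x. Over E, lifts of the theta y_i to E ⊗ K
    are a solution. Stability of [K] under theta is phrased by such lifts because E ⊗ K -> E ⊗ N
    need not be injective. *)
Lemma invariant_span (K : submodule NB) :
  pure (algmap p) -> coassociative -> counital ->
  (forall x, K x -> exists t : tensor EB (submod K),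
      tmap (lid EB) (sub_val K) t = theta x) ->
  forall x, K x -> exists k (e : 'I_k -> E) (y : 'I_k -> NB),
    (forall i, K (y i) /\ invariants (y i)) /\ x = \sum_i e i *: (y i : N).
Proof.
move=> ppure coassoc counit subcomod x Kx.
have [t tx] := subcomod x Kx.
have [k [e [y ty]]] := tensor_sum t.
have lift i := cid (subcomod _ (sub_valP (y i))).
pose d : {linear NB -> tensor EB NB} := theta \- unit_map NB.
pose c := lcomp d (sub_val K).
pose f i := lcomp (homothety p N (e i)) (sub_val K).
have dE u : tmap (lid EB) d u = tmap (lid EB) theta u - tmap (lid EB) (unit_map NB) u.
  elim/tensor_ind: u => [|a b|u v IHu IHv]; first by rewrite !linear0 addr0.
  - by rewrite !tmapE tmulDr -[- unit_map _ _]scaleN1r tmulZr scaleN1r.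
  - by rewrite !linearD IHu IHv; apply: addrACA.
have [||a [ca fa]] := @pure_system _ _ p ppure _ _ _ c k f x (fun i => projT1 (lift i)).
(* Coassociativity says that theta y_i satisfies the invariance equation over E. *)
- by move=> i; rewrite tmap_lcomp (projT2 (lift i)) dE coassoc subrr.
(* By counitality and coassociativity, 1 ⊗ x is [scale_inner] applied to (E ⊗ theta)(theta x), which
   is the sum of the theta y_i with e_i acting on the factor N. *)
- rewrite -[x]counit -scale_inner_unit -coassoc -tx ty.
  rewrite (linear_sum (tmap (lid EB) (sub_val K))) (linear_sum (tmap (lid EB) theta)).
  rewrite (linear_sum (scale_inner N)).
  apply: eq_bigr => i _; rewrite tmap_lcomp (projT2 (lift i)) !tmapE.
  by rewrite !lidE scale_innerE.
exists k, e, (fun i => sub_val K (a i)); split=> [i|]; last by rewrite -fa.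
split; first exact: sub_valP.
by apply/eqP; rewrite -subr_eq0; apply/eqP; apply: ca.
Qed.
End Coaction.
End Comodules.

(** * The coaction of a descent datum and its counit *)

Section DescentCoaction.
Variables (B E : comPzRingType) (p : {rmorphism B -> E}).
Local Notation EB := (restr p E^o).
Local Notation one := (1 : EB).

Section Datum.
Variable D : descent_datum p.
Local Notation N := (dd_mod D).
Local Notation NB := (restr p N).
Local Notation phi := (tens2_base (dd_iso D)).

Lemma coaction_is_linear : linear (fun x : NB => phi (x ⊗ one)).
Proof. by move=> b x y; rewrite tmulDl tmulZl; apply: linearP. Qed.
Definition coaction : {linear NB -> tensor EB NB} := mklin coaction_is_linear.
Lemma coactionE x : coaction x = phi (x ⊗ one).
Proof. by []. Qed.

(** The argument is e ⊗ e' acting on x ⊗ 1, and phi is linear over E ⊗ E; so phi is determined by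
    its coaction. *)
Lemma phi_scale (e e' : E) (x : NB) :
  phi ((e *: (x : N) : NB) ⊗ (e' : EB)) = tact ((e : EB) ⊗ (e' : EB)) (coaction x).
Proof.
rewrite coactionE -[RHS]tens2Z -linearZ_LR tens2_baseE tens2Z tactE.
by congr (dd_iso D (_ ⊗ _)); rewrite -[RHS]/(e' * 1) mulr1.
Qed.

(** This is the cocycle condition at x ⊗ 1 ⊗ 1: the composite of [phi12] and [phi23] iterates the
    coaction, while [phi13] inserts 1 in the middle of the coaction of x. *)
Lemma coaction_coassoc : coassociative coaction.
Proof.
move=> x; have := dd_cocycle (x ⊗ one ⊗ one).
have insE w : tmap (lid EB) phi (tassoc EB NB EB (w ⊗ one)) = tmap (lid EB) coaction w.
  elim/tensor_ind: w => [|e y|u v IHu IHv]; first by rewrite tmul0l !linear0.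
  - by rewrite tassocE !tmapE.
  - by rewrite tmulDl !linearD IHu IHv.
have swapE w : tmap (lid EB) (tswap NB EB) (tassoc EB NB EB (w ⊗ one)) =
    tmap (lid EB) (unit_map p NB) w.
  elim/tensor_ind: w => [|e y|u v IHu IHv]; first by rewrite tmul0l !linear0.
  - by rewrite tassocE !tmapE tswapE.
  - by rewrite tmulDl !linearD IHu IHv.
rewrite /phi13 /phi23 /phi12 !lcompE tassocE !tmapE tswapE tassocVE tmapE.
by rewrite !lidE -coactionE insE swapE.
Qed.

(* With psi := (action o coaction), coassociativity yields (E ⊗ psi) o coaction =
   coaction, hence (E ⊗ psi) o phi = phi by linearity; as phi is surjective,
   E ⊗ psi is the identity. *)
Lemma coaction_counit : counital coaction.
Proof.
pose psi := lcomp (scale_map p N) coaction.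
have psiE x : tmap (lid EB) psi (coaction x) = coaction x.
  rewrite tmap_lcomp coaction_coassoc -tmap_lcomp tmap_id // => y.
  by rewrite lcompE unit_mapE scale_mapE scale1r.
have coactZ (e : E) (x : NB) :
    coaction (e *: (x : N) : NB) = tmap (homothety p E^o e) (lid NB) (coaction x).
  rewrite [LHS]phi_scale; elim/tensor_ind: (coaction x) => [|a y|u v IHu IHv].
  - by rewrite tact0r linear0.
  - by rewrite tactE tmapE homothetyE lidE scale1r.
  - by rewrite tactDr IHu IHv linearD.
have scale_homothety (e : E) t :
    scale_map p N (tmap (homothety p E^o e) (lid NB) t) = e *: (scale_map p N t : N).
  elim/tensor_ind: t => [|a y|u v IHu IHv]; first by rewrite !linear0.
  - by rewrite tmapE !scale_mapE homothetyE lidE scalerA.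
  - by rewrite !linearD IHu IHv.
have psiZ (e : E) x : psi (e *: (x : N) : NB) = e *: (psi x : N).
  by rewrite lcompE coactZ scale_homothety.
have psi_tact s t : tmap (lid EB) psi (tact s t) = tact s (tmap (lid EB) psi t).
  elim/tensor_ind: s => [|a c|s s' IHs IHs']; first by rewrite !tact0l linear0.
    elim/tensor_ind: t => [|a' y|t t' IHt IHt'].
    - by rewrite tact0r linear0 tact0r.
    - by rewrite tactE !tmapE !lidE psiZ tactE.
    - by rewrite !(tactDr, linearD) IHt IHt'.
  by rewrite !tactDl linearD IHs IHs'.
have psi_phi t : tmap (lid EB) psi (phi t) = phi t.
  elim/tensor_ind: t => [|x e|t u IHt IHu]; first by rewrite !linear0.
  - by rewrite -[x]scale1r phi_scale psi_tact psiE.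
  - by rewrite !linearD IHt IHu.
move=> x; case: (dd_bij D) => phiV _ phiK.
have := psi_phi (phiV (one ⊗ x)); rewrite !tens2_baseE phiK tmapE lidE.
by move/(congr1 (scale_map p N)); rewrite !scale_mapE !scale1r.
Qed.

Definition descent_invariants : lmodType B := submod (invariants coaction).

Definition counit_base : {linear tensor EB descent_invariants -> NB} :=
  lcomp (scale_map p N) (tmap (lid EB) (sub_val (invariants coaction))).
Lemma counit_is_linear :
  linear (fun t : extend p descent_invariants => counit_base t : N).
Proof.
move=> e t u; rewrite [LHS](linearD counit_base); congr (_ + _).
elim/extend_ind: t => [|a x|t v IHt IHv].
- by rewrite scaler0 linear0 scaler0.
- by rewrite emulZ /counit_base !lcompE !tmapE !scale_mapE scalerA.
- by rewrite scalerDr !(linearD counit_base) IHt IHv scalerDr.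
Qed.
Definition counit : {linear extend p descent_invariants -> N} :=
  mklin counit_is_linear.

Lemma counitE e x : counit (emul p e x) = e *: (sub_val _ x : N).
Proof. by rewrite mklinE /counit_base lcompE tmapE scale_mapE. Qed.

(** As m is invariant, phi (e m ⊗ e') = (e ⊗ e') (1 ⊗ m) = e ⊗ e' m, which is also the image of e ⊗
    (e' ⊗ m). *)
Lemma counit_compatible :
  @dd_compatible _ _ p (can_datum p descent_invariants) D counit.
Proof.
move=> t; change (phi (tmap (restr_hom p counit) (lid EB) t) =
  tmap (lid EB) (restr_hom p counit) (can_isoB p descent_invariants t)).
elim/tensor_extend_ind: t => [|e m e'|t u IHt IHu]; first by rewrite !linear0.
- rewrite can_isoBE !tmapE !restr_homE !counitE !lidE phi_scale.
  rewrite (sub_valP m) tactE; congr (_ ⊗ _); exact: mulr1.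
- by rewrite !linearD IHt IHu.
Qed.
Definition descent_counit : descent_hom (can_datum p descent_invariants) D :=
  DescentHom counit_compatible.

Lemma counit_surj : pure (algmap p) -> forall y, exists t, counit t = y.
Proof.
move=> ppure y.
have full x : full_sub NB x -> exists t : tensor EB (submod (full_sub NB)),
    tmap (lid EB) (sub_val (full_sub NB)) t = coaction x.
  move=> _; pose i := corestr (f := lid NB) (S := full_sub NB) (fun=> I).
  exists (tmap (lid EB) i (coaction x)).
  by rewrite -tmap_lcomp tmap_id.
have [k [e [x [xinv ->]]]] :=
  invariant_span ppure coaction_coassoc coaction_counit full (I : full_sub NB y).
exists (\sum_i emul p (e i) (mksub (xinv i).2 : descent_invariants)).
by rewrite linear_sum; apply: eq_bigr => i _; rewrite counitE.
Qed.
End Datum.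
End DescentCoaction.

(** * Bijectivity of the unit and the counit for a pure morphism *)

Section Pure.
Variables (B E : comPzRingType) (p : {rmorphism B -> E}).
Local Notation EB := (restr p E^o).

Section Extension.
Variable M : lmodType B.
Local Notation can_coaction := (coaction (can_datum p M)).

(** The canonical datum sends (e ⊗ m) ⊗ 1 to e ⊗ (1 ⊗ m). *)
Lemma can_coactionE (t : extend p M) :
  can_coaction t = tmap (lid EB) (emulL p M 1) t.
Proof.
rewrite coactionE -[LHS]/(can_isoB p M _).
elim/extend_ind: t => [|e m|t u IHt IHu].
- by rewrite tmul0l linear0; symmetry; apply: (linear0 (tmap (lid EB) (emulL p M 1))).
- by rewrite can_isoBE; symmetry; apply: tmapE.
- rewrite tmulDl linearD IHt IHu; symmetry.
  exact: (linearD (tmap (lid EB) (emulL p M 1))).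
Qed.

Lemma emul1_invariant m : invariants can_coaction (emulL p M 1 m).
Proof. by apply: (etrans (can_coactionE _)); apply: tmapE. Qed.

Definition descent_unit : {linear M -> descent_invariants (can_datum p M)} :=
  corestr emul1_invariant.

Hypothesis ppure : pure (algmap p).

Lemma emul1_inj (m : M) : emul p 1 m = 0 -> m = 0.
Proof. exact: (pure_algmap p).1 ppure M m. Qed.

(** Invariance says that t itself solves, over E, the equation 1 ⊗ m = t in the unknown m; purity
    yields a solution in M. *)
Lemma invariant_emul1 (t : extend p M) :
  invariants can_coaction t -> exists m, t = emul p 1 m.
Proof.
move/(etrans (esym (can_coactionE t))) => tinv.
(* One unknown and one equation; the zero map makes the side condition empty. *)
have [||a [_ <-]] := @pure_system _ _ p ppure _ M _ (\0 : {linear M -> M}) 1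
  (fun=> emulL p M 1) t (fun=> t).
- move=> _; elim/tensor_ind: t {tinv} => [|e m|t u IHt IHu]; first by rewrite linear0.
  + by rewrite tmapE tmul0r.
  + by rewrite linearD IHt IHu addr0.
- by rewrite big_ord1.
- by exists (a ord0); rewrite big_ord1.
Qed.
End Extension.

(** The kernel of the counit is stable under the coaction, so invariants lying in it generate it.
    Such an invariant is some 1 ⊗ m, which the counit sends to m; hence m = 0. *)
Lemma counit_inj (D : descent_datum p) (t : extend p (descent_invariants D)) :
  pure (algmap p) -> counit D t = 0 -> t = 0.
Proof.
move=> ppure ct.
pose M := descent_invariants D.
pose P := can_datum p M.
pose eps : {linear restr p (extend p M) -> restr p (dd_mod D)} :=
  restr_hom p (counit D).
have epsE x : tmap (lid EB) eps (coaction P x) = coaction D (eps x).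
  rewrite /P can_coactionE; elim/extend_ind: x => [|e m|x y IHx IHy].
  - by rewrite (linear0 eps) !linear0.
  - rewrite (tmapE (lid EB) (emulL p M 1)) tmapE !lidE /eps !restr_homE emulLE !counitE.
    rewrite scale1r coactionE phi_scale (sub_valP m) tactE; congr (_ ⊗ _).
      by symmetry; apply: mulr1.
    by rewrite scale1r.
  - rewrite (linearD (tmap (lid EB) (emulL p M 1))) linearD IHx IHy.
    by rewrite (linearD eps) linearD.
have eps_surj y : exists x, eps x = y by exact: counit_surj.
(* The coaction of x is killed by E ⊗ [eps]; as [eps] is onto, right exactness lifts it to E ⊗
   ker. *)
have subcomod x : ker_sub eps x -> exists u : tensor EB (submod (ker_sub eps)),
    tmap (lid EB) (sub_val (ker_sub eps)) u = coaction P x.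
  by move=> epsx; apply: (tensor_right_exact eps_surj); rewrite epsE epsx linear0.
have [k [e [x [xP ->]]]] :=
  invariant_span ppure (@coaction_coassoc _ _ p P) (@coaction_counit _ _ p P)
    subcomod ct.
rewrite big1 // => i _; have [epsx /(invariant_emul1 ppure) [m xm]] := xP i.
have {epsx} : counit D (x i) = 0 := epsx; rewrite xm counitE scale1r => m0.
have -> : m = 0 by apply: sub_val_inj; rewrite m0 linear0.
by rewrite /emul tmul0r scaler0.
Qed.
End Pure.

(** * Equivalences of categories are faithful *)

Section Equivalence.
Variables (C D : category) (F : functor C D).

(** By naturality, f is recovered from its image as eta^-1 (G F f) eta. *)
Lemma equivalence_faithful x y (f g : Defs.hom x y) :
  equivalence F -> fhom F f = fhom F g -> f = g.
Proof.
move=> [G [[eta [eta_iso eta_nat]] _]] fg.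
have [h [heta _]] := eta_iso y.
rewrite -[f]comp1m -[g]comp1m -heta -!compmA.
by have := eta_nat _ _ f; have := eta_nat _ _ g => /= -> ->; rewrite fg.
Qed.
End Equivalence.

(** * The two implications between effective descent and purity *)

Section Main.
Variables (B E : comPzRingType) (p : {rmorphism B -> E}).
Local Notation EB := (restr p E^o).
Local Notation one := (1 : EB).

Lemma effective_descent_pure : effective_descent p -> pure (algmap p).
Proof.
move=> eff; apply/pure_algmap => M x x0.
have mulx_lin : linear (fun b : B^o => (b : B) *: x).
  by move=> a b c; rewrite scalerDl -scalerA.
pose f : {linear B^o -> M} := mklin mulx_lin.
pose g : {linear B^o -> M} := \0.
have fg : can_hom p f = can_hom p g.
  apply: descent_hom_ext => t.
  change (extend_hom p f t = extend_hom p g t).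
  elim/extend_ind: t => [|e b|t u IHt IHu].
  - by rewrite !linear0.
  - rewrite !extend_homE /emul mklinE tmul0r tmulZr.
    (* e ⊗ x = e (1 ⊗ x), which vanishes by assumption. *)
    have -> : (e : EB) ⊗ x = tmap (homothety p E^o e) (lid M) (one ⊗ x).
      by rewrite tmapE homothetyE lidE; congr (_ ⊗ _); symmetry; apply: mulr1.
    by rewrite x0 linear0 scaler0.
  - by rewrite !linearD IHt IHu.
have /(congr1 (fun h : {linear B^o -> M} => h 1)) : f = g.
  exact: (equivalence_faithful (F := comparison_functor p) eff fg).
by rewrite mklinE scale1r.
Qed.

(** The linear inverse k is again compatible: use compatibility of h at (k ⊗ E) t, then cancel h by
    E ⊗ k. *)
Lemma descent_bij_iso (D D' : Des p) (h : Defs.hom D D') :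
  injective (dh_map h) -> (forall y, exists x, dh_map h x = y) -> isomorphism h.
Proof.
move=> hinj hsurj; have [k [kh hk]] := bij_iso hinj hsurj.
have khE x : k (dh_map h x) = x by exact: (congr1 (fun l : {linear _ -> _} => l x) kh).
have hkE y : dh_map h (k y) = y by exact: (congr1 (fun l : {linear _ -> _} => l y) hk).
have kcomp : @dd_compatible _ _ p D' D k.
  move=> t; have hkt : tmap (restr_hom p (dh_map h)) (lid EB)
      (tmap (restr_hom p k) (lid EB) t) = t.
    rewrite -(tmap_comp (f'' := lid _) (g'' := lid EB)) ?tmap_id // => y.
    exact: (esym (hkE y)).
  rewrite -[in RHS]hkt (dh_compatible h).
  rewrite -(tmap_comp (f'' := lid EB) (g'' := lid _)) ?tmap_id // => y.
  exact: (esym (khE y)).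
exists (DescentHom kcomp : @Defs.hom (Des p) D' D).
by split; apply: descent_hom_ext => x; [apply: khE | apply: hkE].
Qed.

Section Inverse.
Hypothesis ppure : pure (algmap p).

(** Compatibility at x ⊗ 1 says that h commutes with the coactions. *)
Lemma invariants_hom_closed (D D' : descent_datum p) (h : descent_hom D D') x :
  invariants (coaction D')
    (lcomp (restr_hom p (dh_map h)) (sub_val (invariants (coaction D))) x).
Proof.
have xinv : coaction D (sub_val _ x) = one ⊗ sub_val _ x := sub_valP x.
have := dh_compatible h (sub_val _ x ⊗ one).
rewrite tmapE lidE => hx; apply: (etrans hx).
by rewrite -[dd_iso D _]coactionE xinv tmapE.
Qed.
Definition invariants_hom (D D' : descent_datum p) (h : descent_hom D D') :
  {linear descent_invariants D -> descent_invariants D'} :=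
  corestr (invariants_hom_closed h).

Lemma invariants_hom1 D : invariants_hom (descent_id D) = lid _.
Proof. by apply: linear_ext => x; apply: sub_val_inj. Qed.
Lemma invariants_homM D D' D'' (g : descent_hom D' D'') (f : descent_hom D D') :
  invariants_hom (descent_comp g f) = lcomp (invariants_hom g) (invariants_hom f).
Proof. by apply: linear_ext => x; apply: sub_val_inj. Qed.
Definition invariants_functor : functor (Des p) (Mod B) :=
  @Functor (Des p) (Mod B) (@descent_invariants B E p) invariants_hom
    invariants_hom1 invariants_homM.

(** The quasi-inverse takes invariants; the natural isomorphisms are m |-> 1 ⊗ m and e ⊗ x |-> e
    x. *)
Lemma pure_effective_descent : effective_descent p.
Proof.
exists invariants_functor; split.
- exists (fun M => descent_unit p M : @Defs.hom (Mod B) _ _); split=> [M|M M' f].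
  + apply: bij_iso => [|y].
      apply: linear_inj => m /(congr1 (sub_val _)); rewrite corestrE linear0.
      exact: emul1_inj.
    have [m ym] := invariant_emul1 ppure (sub_valP y).
    by exists m; apply: sub_val_inj; rewrite corestrE.
  + apply: linear_ext => x; apply: sub_val_inj; symmetry.
    exact: (extend_homE p f 1 x).
- exists (fun D => descent_counit D : @Defs.hom (Des p) _ _); split=> [D|D D' h].
  + apply: descent_bij_iso; last exact: counit_surj.
    by apply: linear_inj => t; apply: counit_inj.
  + apply: descent_hom_ext => t.
    change (counit D' (extend_hom p (invariants_hom h) t) = dh_map h (counit D t)).
    elim/extend_ind: t => [|e x|t u IHt IHu]; first by rewrite !linear0.
    * by rewrite extend_homE !counitE linearZ.
    * by rewrite !linearD IHt IHu.
Qed.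
End Inverse.
End Main.

Theorem theorem2p4 (B E : comPzRingType) (p : {rmorphism B -> E}) :
  effective_descent p <-> pure (algmap p).
Proof. by split; [apply: effective_descent_pure | apply: pure_effective_descent]. Qed.
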